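(* Let $k\ge 1$ and $n\ge 1$ be integers. There is a bijection between the set of multicompositions $$C_+^k(n,1)\cup C_+^k(n-1,2)\cup\cdots=\bigcup_{i\ge 1}C_+^k(n+1-i,i)$$ and the set $C_{\hat 1}^k(n+1)$. Therefore, $$J^k(n)=\sum_{i\ge 1}k^{i-1}\binom{n-i}{i-1}.$$
   Context: For positive integers $k$ and $n$, a $k$-composition of $n$ (multicomposition) is an ordered sequence of positive integers with sum $n$ in which, in addition, each positive part except the first may be immediately preceded by up to $k-1$ zeros (equivalently, a composition of $n$ into positive parts, each assigned a color in $\{1,\dots,k\}$, with the first part having color 1; the two versions correspond by replacing each part $c$ with color $\ell$ by $\ell-1$ zeros followed by $c$). $C_+^k(n,\ell)$ is the set of $k$-compositions of $n$ with exactly $\ell$ positive parts (empty if $n\le 0$). $C_{\hat 1}^k(n)$ is the set of $k$-compositions of $n$ with no part equal to $1$. The $k$-Jacobsthal sequence is defined by $J^k(0)=0$, $J^k(1)=1$, and $J^k(n)=J^k(n-1)+kJ^k(n-2)$ for $n\ge 2$. Binomial coefficients $\binom{a}{b}$ are taken to be $0$ when $a<0$ or $b>a$, so the sum is finite. *)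

(* Defs.v *)
From mathcomp Require Import all_boot.
From mathcomp Require Import boolp classical_sets functions cardinality fsbigop.

Set Implicit Arguments.
Unset Strict Implicit.
Unset Printing Implicit Defensive.

Local Open Scope classical_set_scope.

(* A list of nonnegative parts: a positive part [c], followed by blocks
   [(z, d)], each standing for z <= k - 1 zeros and then the positive part d.
   As [c] is positive, [multicomp k 0] is empty. *)
Definition multicomp (k n : nat) : set (seq nat) :=
  [set s | (exists (c : nat) (t : seq (nat * nat)),
              [/\ 0 < c,
                  all (fun b => (b.1 < k) && (0 < b.2)) t &
                  s = c :: flatten [seq rcons (nseq b.1 0) b.2 | b <- t]]) /\
           sumn s = n].

(* C_+^k(n, l).  It is empty for n = 0, so a truncated first argument [m - i]
   yields the empty set when m <= i, as is the convention for n <= 0. *)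
Definition multicomp_pos (k n l : nat) : set (seq nat) :=
  [set s | multicomp k n s /\ count (fun p => 0 < p) s = l].

(* C_{\hat 1}^k(n) *)
Definition multicomp_no1 (k n : nat) : set (seq nat) :=
  [set s | multicomp k n s /\ 1 \notin s].

Fixpoint jacobsthal (k n : nat) : nat :=
  match n with
  | 0 => 0
  | m.+1 => match m with
            | 0 => 1
            | p.+1 => jacobsthal k m + k * jacobsthal k p
            end
  end.

(* Main.v *)
Require Import Defs.
From mathcomp Require Import all_boot.
From mathcomp Require Import boolp classical_sets functions cardinality fsbigop.

Local Open Scope classical_set_scope.

(** The bijection adds 1 to every positive part and leaves the zeros alone.
    Whether a list is a k-composition depends only on which of its entries are
    positive, so the result is again a k-composition ([multicomp_map]); it has
    no part 1, and its sum has grown by the number of positive parts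
    ([sumn_grow]).  A k-composition of n + 1 - i with i positive parts thus
    becomes one of n + 1, for every i.  Conversely, when no part is 1,
    subtracting 1 from every positive part keeps it positive, and truncated
    subtraction fixes the zeros, so [predn] undoes the map.

    For the formula, put D(n) = sum over j of k^j C(n - j, j), the sum of the
    statement shifted by one.  Pascal's rule applied to the terms with j > 0
    gives D(n + 2) = D(n + 1) + k D(n) ([diag_binSS]), the recurrence of the
    k-Jacobsthal numbers, with D(0) = D(1) = 1; hence J(n + 1) = D(n). *)

Definition grow (p : nat) : nat := p + (0 < p).

Lemma growK : cancel grow predn.
Proof. by case=> //= p; rewrite /grow addn1. Qed.

Lemma predn_growK (p : nat) : p != 1 -> grow p.-1 = p.
Proof. by case: p => [|[|p]] //= _; rewrite /grow addn1. Qed.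

Lemma grow_neq1 (p : nat) : grow p != 1.
Proof. by case: p => //= p; rewrite /grow addn1. Qed.

Lemma sumn_grow (s : seq nat) :
  sumn (map grow s) = sumn s + count (fun p => 0 < p) s.
Proof. by elim: s => //= p s ->; rewrite /grow addnACA. Qed.

(** The defining condition of a k-composition only sees the set of positions
    of its positive entries, so a map that preserves positivity on the entries
    preserves it.  Restricting the hypothesis to the entries of [s] is what
    lets this apply to [predn], which sends 1 to 0. *)
Lemma multicomp_map (k n : nat) (g : nat -> nat) (s : seq nat) :
  {in s, forall p, (0 < g p) = (0 < p)} ->
  multicomp k n s -> multicomp k (sumn (map g s)) (map g s).
Proof.
move=> gpos [[c [t [c_gt0 t_ok def_s]]] _]; split=> //.
exists (g c), [seq (b.1, g b.2) | b <- t].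
rewrite {}def_s in gpos *.
have gc_gt0 : 0 < g c by rewrite gpos // mem_head.
have {}gpos : {in flatten [seq rcons (nseq b.1 0) b.2 | b <- t],
    forall p, (0 < g p) = (0 < p)}.
  by move=> p tp; apply: gpos; rewrite inE tp orbT.
suff [all_t eq_t] :
    all (fun b => (b.1 < k) && (0 < b.2)) [seq (b.1, g b.2) | b <- t] /\
    map g (flatten [seq rcons (nseq b.1 0) b.2 | b <- t]) =
    flatten [seq rcons (nseq b.1 0) b.2 | b <- [seq (b.1, g b.2) | b <- t]].
  by split=> //; rewrite /= eq_t.
elim: t t_ok gpos => //= -[z d] t IHt /= /andP[/andP[z_lt d_gt0] t_ok] gpos.
have [|all_t eq_t] := IHt t_ok.
  by move=> p tp; apply: gpos; rewrite mem_cat tp orbT.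
rewrite z_lt gpos ?mem_cat ?mem_rcons ?mem_head // d_gt0 all_t; split=> //.
rewrite map_cat map_rcons map_nseq eq_t.
(* Only a block with at least one zero gives information on [g 0]. *)
case: z {z_lt} gpos => // z gpos.
have /eqP -> // : g 0 == 0.
by rewrite -leqn0 leqNgt gpos // mem_cat mem_rcons !inE eqxx orbT.
Qed.

Lemma multicomp_count_gt0 (k n : nat) (s : seq nat) :
  multicomp k n s -> 0 < count (fun p => 0 < p) s.
Proof. by move=> [[c [t [c_gt0 _ ->]]] _] /=; rewrite c_gt0. Qed.

Lemma multicomp_gt0 (k n : nat) (s : seq nat) : multicomp k n s -> 0 < n.
Proof. by move=> [[c [t [c_gt0 _ ->]]] <-] /=; rewrite addn_gt0 c_gt0. Qed.

Lemma grow_set_bij (k n : nat) :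
  set_bij (\bigcup_(i in [set i : nat | 1 <= i]) multicomp_pos k (n - i) i)
          (multicomp_no1 k n) (map grow).
Proof.
split.
- move=> s [i /= _ [s_mc s_count]]; split; last first.
    by apply/mapP=> -[p _ /esym/eqP]; rewrite (negPf (grow_neq1 p)).
  (* A k-composition has a positive sum, so [n - i] is not truncated here. *)
  have lt_in : i < n by rewrite -subn_gt0 (multicomp_gt0 _ _ _ s_mc).
  have -> : n = sumn (map grow s).
    by case: s_mc => _ sum_s; rewrite sumn_grow s_count sum_s subnK // ltnW.
  by apply: multicomp_map s_mc => p _; rewrite addn_gt0; case: (0 < p).
- by move=> s t _ _ /(inj_map (can_inj growK)).
- move=> s [s_mc s_no1].
  have growKs : map grow (map predn s) = s.
    rewrite -map_comp map_id_in // => p sp /=; apply: predn_growK.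
    by apply: contraNneq s_no1 => <-.
  have t_mc : multicomp k (sumn (map predn s)) (map predn s).
    apply: multicomp_map s_mc => -[|[|p]] // s1.
    by rewrite s1 in s_no1.
  exists (map predn s) => //.
  exists (count (fun p => 0 < p) (map predn s)).
    exact: multicomp_count_gt0 t_mc.
  split=> //; suff -> : n - count (fun p => 0 < p) (map predn s)
                        = sumn (map predn s) by [].
  by case: s_mc => _ <-; rewrite -{1}growKs sumn_grow addnK.
Qed.

Definition diag_bin (k n : nat) : nat := \sum_(j < n.+1) k ^ j * 'C(n - j, j).

Lemma diag_binS (k n : nat) :
  diag_bin k n.+1 = 1 + \sum_(j < n.+1) k ^ j.+1 * 'C(n - j, j.+1).
Proof. by rewrite /diag_bin big_ord_recl expn0 bin0. Qed.

Lemma diag_binSS (k n : nat) :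
  diag_bin k n.+2 = diag_bin k n.+1 + k * diag_bin k n.
Proof.
rewrite 2!diag_binS big_ord_recr /= subnn bin0n muln0 addn0 -addnA.
congr (1 + _); rewrite /diag_bin big_distrr -big_split /=.
apply: eq_bigr => j _.
by rewrite subSn -1?ltnS // binS mulnDr expnS mulnA.
Qed.

Lemma jacobsthalS (k n : nat) : jacobsthal k n.+1 = diag_bin k n.
Proof.
(* The recurrence has order two, so consecutive values go together. *)
suff [] : jacobsthal k n.+1 = diag_bin k n /\
          jacobsthal k n.+2 = diag_bin k n.+1 by [].
elim: n => [|n [IH0 IH1]].
  by rewrite /diag_bin !big_ord_recr !big_ord0 /= !muln0.
by split=> //; rewrite diag_binSS -IH0 -IH1.
Qed.

(** The index set is infinite, but for i > n + 1 the truncated n + 1 - i is 0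
    while i - 1 > 0, so the binomial vanishes.  The successor matters: with
    upper entries 0 - i the term i = 1 would be C(0, 0) = 1, not J(0) = 0. *)
Lemma fsbig_diag_bin (k n : nat) :
  \big[addn/0]_(i \in [set i : nat | 1 <= i])
     (k ^ (i - 1) * 'C(n.+1 - i, i - 1)) = diag_bin k n.
Proof.
rewrite -(fsbig_widen [set` index_iota 1 n.+2]) /=; first last.
- move=> [|i] /= [] // _; rewrite mem_index_iota /= => /negP.
  rewrite ltnS -leqNgt subn1 /= subSS => /[dup] lt_ni /ltnW/eqP ->.
  by rewrite bin0n eqn0Ngt (leq_ltn_trans _ lt_ni) ?muln0.
- by move=> i /=; rewrite mem_index_iota => /andP[].
rewrite -fsbig_seq ?iota_uniq // big_add1 /= big_mkord.
by apply: eq_bigr => j _; rewrite subn1 subSS.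
Qed.

Theorem theorem10 (k n : nat) (hk : 1 <= k) (hn : 1 <= n) :
  (exists f : seq nat -> seq nat,
     set_bij (\bigcup_(i in [set i : nat | 1 <= i]) multicomp_pos k (n + 1 - i) i)
             (multicomp_no1 k (n + 1)) f) /\
  jacobsthal k n =
    \big[addn/0]_(i \in [set i : nat | 1 <= i])
       (k ^ (i - 1) * 'C(n - i, i - 1)).
Proof.
split; first by exists (map grow); apply: grow_set_bij.
by case: n hn => // n _; rewrite fsbig_diag_bin jacobsthalS.
Qed.
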